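(* Let $\tau$ be a finite type, and let $f\in\Omega_{\tau\to\tau}$ and $x\in\Omega_\tau$ be hereditarily positive. Then for all countable ordinals $\alpha$ and $\gamma$: (1) $I_\alpha^\tau f(I_\gamma^\tau f x) =^{\mathrm{hp}} I_{\gamma+\alpha}^\tau f x$; (2) $I_\alpha^\tau(I_\gamma^\tau f) =^{\mathrm{hp}} I_{\gamma\alpha}^\tau f$; (3) $I_\alpha^{\tau\to\tau}(I_\gamma^\tau) =^{\mathrm{hp}} I_{\gamma^\alpha}^\tau$. Here $\gamma+\alpha$, $\gamma\alpha$, $\gamma^\alpha$ are ordinal sum, product and power.
   Context: $\Omega$ is the first uncountable ordinal (its elements are the countable ordinals). Finite types are generated from a base type $o$ by $\sigma,\tau\mapsto\sigma\to\tau$. The full type structure: $\Omega_o=\Omega$ with the usual order; $\Omega_{\sigma\to\tau}$ is the set of all functions $\Omega_\sigma\to\Omega_\tau$, ordered pointwise by $\le$. Suprema and infima are computed pointwise. For nonzero countable $\zeta$, $\limsup_{\xi\to\zeta}\{x_\xi\}=\inf_{\gamma<\zeta}\sup_{\gamma\le\xi<\zeta}x_\xi$. For each type $\sigma$ and countable ordinal $\alpha$, $I_\alpha^\sigma\in\Omega_{(\sigma\to\sigma)\to(\sigma\to\sigma)}$ is defined by (application associates to the left): $I_0^\sigma fx=x$; $I_{\alpha+1}^\sigma fx=f(I_\alpha^\sigma fx)$; $I_\mu^\sigma fx=\limsup_{\xi\to\mu}\{I_\xi^\sigma fx\}$ for limit $\mu$. Hereditarily positive (h.p.) functionals and the relation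 $\le^{\mathrm{hp}}$ are defined simultaneously by induction on type. Every element of $\Omega_o$, and every element of $\Omega_{\rho\to\tau}$ with $\rho\ne\tau$, is h.p., and on these types $\le^{\mathrm{hp}}$ is $\le$. For $f\in\Omega_{\tau\to\tau}$, $f$ is h.p. iff: (i) $fx$ is h.p. for every h.p. $x\in\Omega_\tau$; (ii) $x\le^{\mathrm{hp}}fx$ for every h.p. $x\in\Omega_\tau$; (iii) $fx\le^{\mathrm{hp}}fx'$ whenever $x,x'\in\Omega_\tau$ are h.p. and $x\le^{\mathrm{hp}}x'$. For arbitrary $f,f'\in\Omega_{\tau\to\tau}$ (not necessarily h.p.), $f\le^{\mathrm{hp}}f'$ iff $fx\le^{\mathrm{hp}}f'x$ for all h.p. $x\in\Omega_\tau$. Finally $f=^{\mathrm{hp}}g$ means $f\le^{\mathrm{hp}}g$ and $g\le^{\mathrm{hp}}f$. Ordinal arithmetic conventions: $\gamma(\delta+1)=\gamma\delta+\gamma$; $\gamma^0=1$, $\gamma^{\delta+1}=\gamma^\delta\gamma$, and $0^\alpha=0$ for every $\alpha>0$. *)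

(* Defs.v *)
From HB Require Import structures.
From mathcomp Require Import all_boot all_order.
From mathcomp Require Import boolp classical_sets functions cardinality.
From mathcomp Require wochoice.

Set Implicit Arguments.
Unset Strict Implicit.
Unset Printing Implicit Defensive.

Import Order.TTheory.
Local Open Scope classical_set_scope.
Local Open Scope order_scope.

(* Fix a well-ordering of the (uncountable) powerset of nat.  The points with
   countably many predecessors form an initial segment of it, of order type
   omega_1: see Omega_min, countable_below and Omega_uncountable. *)
Definition wo_rel : rel (set nat) :=
  sval (wochoice.well_ordering_principle (set nat)).

Record Omega := MkOmega {
  Omega_val :> set nat;
  _ : `[< countable [set y | wo_rel y Omega_val] >] }.

HB.instance Definition _ := [isSub for Omega_val].
HB.instance Definition _ := [Choice of Omega by <:].

Lemma wo_relP : wochoice.well_order wo_rel.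
Proof. exact: (svalP (wochoice.well_ordering_principle _)). Qed.

Lemma wo_rel_min (A : set (set nat)) :
  A !=set0 -> exists2 m, A m & forall y, A y -> wo_rel m y.
Proof.
move=> [x Ax]; have [|m [[mA mle] _]] := wo_relP (A := mem A).
  by exists x; rewrite inE.
exists m; first by move: mA; rewrite inE.
by move=> y Ay; apply: mle; rewrite inE.
Qed.

Lemma wo_rel_total : total wo_rel.
Proof.
move=> x y; have [|m [->|->] h] := @wo_rel_min [set x; y].
- by exists x; left.
- by rewrite h //; right.
- by rewrite orbC h //; left.
Qed.

Lemma wo_rel_refl : reflexive wo_rel.
Proof. by move=> x; have := wo_rel_total x x; rewrite orbb. Qed.

Lemma wo_rel_anti : antisymmetric wo_rel.
Proof.
move=> x y /andP[xy yx]; have [|m [_ mU]] := wo_relP (A := mem [set x; y]).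
  by exists x; rewrite inE; left.
by rewrite -(mU x) ?(mU y) //; split; rewrite ?inE; [right| |left|];
   move=> // z; rewrite inE => -[->|->] //; exact: wo_rel_refl.
Qed.

Lemma wo_rel_trans : transitive wo_rel.
Proof.
move=> y x z xy yz; have [|m /= mA h] := @wo_rel_min [set t | t \in [:: x; y; z]].
  by exists x; rewrite /= mem_head.
have mx := h x; have my := h y; have mz := h z; rewrite /= !inE !eqxx !orbT in mx my mz.
move: mA mx my mz; rewrite !inE => /or3P[] /eqP -> mx my mz.
- exact: mz.
- by rewrite (@wo_rel_anti x y) // xy mx.
- by rewrite -(@wo_rel_anti y z) // yz my.
Qed.

Fact Omega_display : Order.disp_t. Proof. exact: Order.Disp tt tt. Qed.

Definition Omega_le (x y : Omega) : bool := wo_rel x y.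

Lemma Omega_le_refl : reflexive Omega_le.
Proof. by move=> x; exact: wo_rel_refl. Qed.

Lemma Omega_le_anti : antisymmetric Omega_le.
Proof. by move=> x y /wo_rel_anti /val_inj. Qed.

Lemma Omega_le_trans : transitive Omega_le.
Proof. by move=> y x z; exact: wo_rel_trans. Qed.

HB.instance Definition _ := Order.Le_isPOrder.Build Omega_display Omega
  Omega_le_refl Omega_le_anti Omega_le_trans.

Lemma Omega_le_total : total (<=%O : rel Omega).
Proof. by move=> x y; exact: wo_rel_total. Qed.

HB.instance Definition _ :=
  Order.POrder_isTotal.Build Omega_display Omega Omega_le_total.

Lemma Omega_min (A : set Omega) :
  A !=set0 -> exists2 m, A m & forall y, A y -> m <= y.
Proof.
move=> [x Ax]; have [|_ [m Am <-] h] := @wo_rel_min (Omega_val @` A).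
  by exists (val x), x.
by exists m => // y Ay; apply: h; exists y.
Qed.

Lemma Omega_lt_wf : well_founded (<%O : rel Omega).
Proof.
move=> x; apply: contrapT => nx.
have [|m nm h] := @Omega_min [set y | ~ Acc (<%O : rel Omega) y]; first by exists x.
apply: nm; split=> y ym; apply: contrapT => /h.
by rewrite leNgt ym.
Qed.

Lemma countable_below (x : Omega) : countable [set y : Omega | y <= x].
Proof.
case: x => x px; have /asboolP/countable_injP[g ginj] := px.
apply/countable_injP; exists (g \o Omega_val) => y z.
by rewrite !inE /= => yx zx /ginj-/(_ _ _)/val_inj; apply; rewrite inE.
Qed.

Lemma Omega_uncountable : ~ countable [set: Omega].
Proof.
move=> cO.
pose S : set (set nat) := [set x | countable [set y | wo_rel y x]].
have cS : countable S.
  have -> : S = Omega_val @` setT.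
    apply/seteqP; split => [x Sx|_ [[x /asboolP px] _ <-]] //.
    by exists (@MkOmega x (introT (asboolP _) Sx)).
  by apply: sub_countable cO; exact: card_image_le.
have Sdown x y : S x -> wo_rel y x -> S y.
  move=> Sx yx; apply: (sub_countable _ Sx); apply: subset_card_le => z zy /=.
  exact: wo_rel_trans zy yx.
have [Sall|/existsNP[x0 Sx0]] := pselect (forall x, S x).
  have [f /in2TT finj] : exists f : set nat -> nat, {in setT &, injective f}.
    by apply/countable_injP; rewrite (_ : setT = S) //; apply/seteqP; split.
  pose D := [set n | exists2 A, f A = n & ~ A n].
  have [DD|nDD] := pselect (D (f D)); last by apply: (nDD); exists D.
  by have [A /finj -> nD] := DD; exact: nD DD.
have [|m nSm h] := @wo_rel_min (~` S); first by exists x0.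
apply: nSm; rewrite /S /=.
apply: (@sub_countable _ _ _ (S `|` [set m])).
  apply: subset_card_le => y /= ym; have [Sy|/h my] := pselect (S y); first by left.
  by right; apply: wo_rel_anti; rewrite ym my.
by rewrite -bigcup2E; apply: bigcup_countable => // -[|[|i]] _ //=.
Qed.

Lemma Omega_inhabited : exists x : Omega, forall y : Omega, x <= y.
Proof.
have [x] : inhabited Omega.
  apply: contrapT => no; apply: Omega_uncountable.
  by rewrite (_ : setT = set0) //; apply/seteqP; split => // x; case: no.
by have [|m _ h] := @Omega_min setT; [exists x|exists m => y; apply: h].
Qed.

Definition ozero : Omega := sval (cid Omega_inhabited).

Lemma ozero_le x : ozero <= x.
Proof. exact: (svalP (cid Omega_inhabited)). Qed.

(* Junk value ozero when A is empty. *)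
Definition oinf (A : set Omega) : Omega :=
  xget ozero [set m | A m /\ forall y, A y -> m <= y].

(* The least upper bound of A; junk value ozero when A is unbounded, i.e.
   uncountable. *)
Definition osup (A : set Omega) : Omega :=
  oinf [set m | forall y, A y -> y <= m].

Definition osucc (x : Omega) : Omega := oinf [set y | x < y].

Definition oone : Omega := osucc ozero.

Definition is_succ (x : Omega) : Prop := exists y, x = osucc y.

Definition is_limit (x : Omega) : Prop := x <> ozero /\ ~ is_succ x.

Lemma oinfP (A : set Omega) :
  A !=set0 -> A (oinf A) /\ forall y, A y -> oinf A <= y.
Proof.
move=> /Omega_min[m Am h].
exact: (@xgetPex _ ozero [set m | A m /\ forall y, A y -> m <= y] (ex_intro _ m (conj Am h))).
Qed.

Lemma not_countable_above (A : set Omega) :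
  countable A -> exists x, forall y, A y -> y < x.
Proof.
move=> cA; apply: contrapT => no; apply: Omega_uncountable.
apply: (@sub_countable _ _ _ (\bigcup_(a in A) [set y : Omega | y <= a])).
  apply: subset_card_le => x _; have /existsNP[y /not_implyP[Ay]] := (forallNP _).2 no x.
  by rewrite ltNge => /negP; rewrite negbK => xy; exists y.
by apply: bigcup_countable => // a _; exact: countable_below.
Qed.

Lemma osupP (A : set Omega) : countable A ->
  (forall y, A y -> y <= osup A) /\
  (forall m, (forall y, A y -> y <= m) -> osup A <= m).
Proof.
move=> /not_countable_above[x hx]; apply: oinfP.
by exists x => y /hx /ltW.
Qed.

Lemma osuccP x : x < osucc x /\ forall y, x < y -> osucc x <= y.
Proof.
apply: oinfP; have [y hy] := not_countable_above (countable1 x).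
by exists y; apply: hy.
Qed.

Lemma osucc_inj : injective osucc.
Proof.
move=> x y exy; apply/eqP; rewrite eq_le !leNgt.
apply/andP; split; apply/negP => h; have := (osuccP _).2 _ h.
  by rewrite -exy leNgt (osuccP x).1.
by rewrite exy leNgt (osuccP y).1.
Qed.

Lemma osucc_neq0 x : osucc x <> ozero.
Proof. by move=> e; have := (osuccP x).1; rewrite e ltNge ozero_le. Qed.

Section TransfiniteRecursion.
Variables (A : Type) (a0 : A) (s : A -> A) (l : Omega -> (Omega -> A) -> A).

Definition trec_ext (x : Omega) (g : forall y, y < x -> A) (y : Omega) : A :=
  match pselect (y < x) with left h => g y h | right _ => a0 end.

Definition trec_step (x : Omega) (g : forall y, y < x -> A) : A :=
  match pselect (x = ozero) with
  | left _ => a0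
  | right _ =>
    match pselect (is_succ x) with
    | left e => s (trec_ext g (sval (cid e)))
    | right _ => l x (trec_ext g)
    end
  end.

Definition trec : Omega -> A := Fix Omega_lt_wf (fun=> A) trec_step.

Lemma trecE x : trec x = trec_step (fun y (_ : y < x) => trec y).
Proof.
apply: (Fix_eq Omega_lt_wf (fun=> A)) => {}x f g fg; congr trec_step.
by apply: functional_extensionality_dep => y;
   apply: functional_extensionality_dep => h.
Qed.

Lemma trec0 : trec ozero = a0.
Proof. by rewrite trecE /trec_step; case: pselect. Qed.

Lemma trecS x : trec (osucc x) = s (trec x).
Proof.
rewrite trecE /trec_step; case: pselect => [/osucc_neq0//|_].
case: pselect => [e|[]]; last by exists x.
case: cid => y /= /osucc_inj <-; congr s; rewrite /trec_ext.
by case: pselect => // -[]; exact: (osuccP x).1.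
Qed.

Lemma trec_lim x : is_limit x ->
  (forall u v, (forall y, y < x -> u y = v y) -> l x u = l x v) ->
  trec x = l x trec.
Proof.
move=> [x0 xS] lx; rewrite trecE /trec_step; do 2 case: pselect => //= _.
by apply: lx => y yx; rewrite /trec_ext; case: pselect.
Qed.

End TransfiniteRecursion.

Definition osup_lim (mu : Omega) (u : Omega -> Omega) : Omega :=
  osup [set u xi | xi in [set xi | xi < mu]].

Definition oadd (gamma : Omega) : Omega -> Omega := trec gamma osucc osup_lim.

Definition omul (gamma : Omega) : Omega -> Omega :=
  trec ozero (fun d => oadd d gamma) osup_lim.

(* The supremum clause at limits would give 0 ^ mu = 1, since 0 ^ 0 = 1. *)
Definition oexp (gamma alpha : Omega) : Omega :=
  if gamma == ozero then (if alpha == ozero then oone else ozero)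
  else trec oone (fun d => omul d gamma) osup_lim alpha.

Lemma trec_osup_lim a0 s mu : is_limit mu ->
  trec a0 s osup_lim mu = osup_lim mu (trec a0 s osup_lim).
Proof.
move=> mulim; apply: trec_lim => // u v uv; congr osup.
by apply: eq_imagel => xi /uv.
Qed.

Lemma oexpr0 gamma : oexp gamma ozero = oone.
Proof. by rewrite /oexp eqxx trec0; case: ifP. Qed.

Lemma oexp0r alpha : alpha <> ozero -> oexp ozero alpha = ozero.
Proof. by move=> /eqP/negbTE a0; rewrite /oexp eqxx a0. Qed.

Lemma oexprS gamma d : oexp gamma (osucc d) = omul (oexp gamma d) gamma.
Proof.
rewrite /oexp; case: eqP => [->|_]; last exact: trecS.
by case: eqP => [/osucc_neq0//|_]; rewrite /omul trec0.
Qed.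

Inductive ftype : Type := base | arr (sigma tau : ftype).

Notation "s ~~> t" := (arr s t) (at level 55, right associativity).

Fixpoint Fun (s : ftype) : Type :=
  match s with
  | base => Omega
  | sigma ~~> tau => Fun sigma -> Fun tau
  end.

Fixpoint fle (s : ftype) : Fun s -> Fun s -> Prop :=
  match s with
  | base => fun x y => (x <= y : Prop)
  | sigma ~~> tau => fun f g => forall x : Fun sigma, fle (f x) (g x)
  end.

Fixpoint finf (s : ftype) : set (Fun s) -> Fun s :=
  match s with
  | base => oinf
  | sigma ~~> tau => fun A x => finf [set f x | f in A]
  end.

Fixpoint fsup (s : ftype) : set (Fun s) -> Fun s :=
  match s with
  | base => osup
  | sigma ~~> tau => fun A x => fsup [set f x | f in A]
  end.

Definition limsup (s : ftype) (zeta : Omega) (u : Omega -> Fun s) : Fun s :=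
  finf [set fsup [set u xi | xi in [set xi | gamma <= xi < zeta]]
       | gamma in [set gamma | gamma < zeta]].

Definition Iter (sigma : ftype) (alpha : Omega) :
    Fun ((sigma ~~> sigma) ~~> sigma ~~> sigma) :=
  fun f x => trec x f (@limsup sigma) alpha.

Arguments Iter : clear implicits.

Section IterEquations.
Variables (sigma : ftype) (f : Fun (sigma ~~> sigma)) (x : Fun sigma).

Lemma Iter0 : Iter sigma ozero f x = x.
Proof. exact: trec0. Qed.

Lemma IterS alpha : Iter sigma (osucc alpha) f x = f (Iter sigma alpha f x).
Proof. exact: trecS. Qed.

Lemma Iter_lim mu : is_limit mu ->
  Iter sigma mu f x = limsup mu (fun xi => Iter sigma xi f x).
Proof.
move=> mulim; apply: trec_lim => // u v uv; congr finf.
apply: eq_imagel => gamma _; congr fsup.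
by apply: eq_imagel => xi /andP[_ /uv].
Qed.

End IterEquations.

(* The pair (h.p., <=hp).  At sigma ~~> tau with sigma = tau, values in Fun tau
   are transported to Fun sigma, so that the recursion is on sigma only. *)
Fixpoint hp_pair (s : ftype) : (Fun s -> Prop) * (Fun s -> Fun s -> Prop) :=
  match s with
  | base => (fun _ => True, @fle base)
  | sigma ~~> tau =>
    match pselect (tau = sigma) with
    | left e =>
      let: (hp, le) := hp_pair sigma in
      let c (y : Fun tau) : Fun sigma := eq_rect tau Fun y sigma e in
      (fun f => [/\ forall x, hp x -> hp (c (f x)),
                    forall x, hp x -> le x (c (f x)) &
                    forall x x', hp x -> hp x' -> le x x' ->
                      le (c (f x)) (c (f x'))],
       fun f g => forall x, hp x -> le (c (f x)) (c (g x)))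
    | right _ => (fun _ => True, @fle (sigma ~~> tau))
    end
  end.

Definition hp (s : ftype) : Fun s -> Prop := (hp_pair s).1.

Definition hple (s : ftype) : Fun s -> Fun s -> Prop := (hp_pair s).2.

Definition hpeq (s : ftype) (f g : Fun s) : Prop := hple f g /\ hple g f.

Arguments hp : clear implicits.
Arguments hple : clear implicits.
Arguments hpeq : clear implicits.

Lemma hp_base x : hp base x. Proof. by []. Qed.

Lemma hple_base x y : hple base x y = (x <= y) :> Prop. Proof. by []. Qed.

Lemma hp_arr_neq rho tau f : rho <> tau -> hp (rho ~~> tau) f.
Proof. by move=> ne; rewrite /hp /=; case: pselect => // e; case: ne. Qed.

Lemma hple_arr_neq rho tau f g : rho <> tau ->
  hple (rho ~~> tau) f g = fle f g.
Proof. by move=> ne; rewrite /hple /=; case: pselect => // e; case: ne. Qed.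

Lemma hp_arr tau (f : Fun (tau ~~> tau)) : hp (tau ~~> tau) f =
  [/\ forall x, hp tau x -> hp tau (f x),
      forall x, hp tau x -> hple tau x (f x) &
      forall x x', hp tau x -> hp tau x' -> hple tau x x' ->
        hple tau (f x) (f x')].
Proof.
rewrite /hp /hple /=; case: pselect => [e|[]//].
by rewrite (Prop_irrelevance e erefl); case: (hp_pair tau).
Qed.

Lemma hple_arr tau (f g : Fun (tau ~~> tau)) : hple (tau ~~> tau) f g =
  (forall x, hp tau x -> hple tau (f x) (g x)).
Proof.
rewrite /hp /hple /=; case: pselect => [e|[]//].
by rewrite (Prop_irrelevance e erefl); case: (hp_pair tau).
Qed.

(* Main.v *)
(* On a family increasing for <=hp (eventually is enough), the limsup is the
   <=hp-least upper bound.  Hence for h.p. f and x the iterates I_alpha f x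
   increase with alpha and commute up to =hp with suprema of ordinals, and the
   three laws follow by transfinite induction on alpha.  I_gamma is itself h.p.
   only if gamma is nonzero; for (3) with gamma = 0, the iterates of I_0 are
   the identity from the first one on, so their limsup forgets the initial f. *)
From mathcomp Require Import all_boot all_order.
From mathcomp Require Import boolp classical_sets cardinality.
Require Import Defs.

Set Implicit Arguments.
Unset Strict Implicit.
Unset Printing Implicit Defensive.

Import Order.TTheory.
Local Open Scope classical_set_scope.
Local Open Scope order_scope.

(** * Transfinite induction, successors and limits in [Omega] *)

Lemma Omega_ind (P : Omega -> Prop) :
  P ozero -> (forall a, P a -> P (osucc a)) ->
  (forall mu, is_limit mu -> (forall xi, xi < mu -> P xi) -> P mu) ->
  forall a, P a.
Proof.
move=> P0 PS Pl; apply: (well_founded_ind Omega_lt_wf) => a IH.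
have [->//|a0] := pselect (a = ozero).
have [[b ab]|aS] := pselect (is_succ a); last exact: Pl.
by rewrite ab; apply/PS/IH; rewrite ab (osuccP b).1.
Qed.

Lemma lt0o a : a <> ozero -> ozero < a.
Proof. by move=> /eqP a0; rewrite lt_def a0 ozero_le. Qed.

Lemma lto_succ a b : (a < osucc b) = (a <= b).
Proof.
apply/idP/idP => [|ab]; last exact: le_lt_trans ab (osuccP b).1.
by apply: contraTT; rewrite -ltNge -leNgt => /(osuccP b).2.
Qed.

Lemma limit_gt0 mu : is_limit mu -> ozero < mu.
Proof. by move=> [/lt0o]. Qed.

Lemma limit_succ_lt mu a : is_limit mu -> a < mu -> osucc a < mu.
Proof.
move=> [_ muS] /(osuccP a).2; rewrite le_eqVlt => /orP[/eqP e|//].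
by case: muS; exists a.
Qed.

(** This makes [osupP] applicable, so that suprema are genuine. The predicate [P] covers both whole
    initial segments ([osup_lim]) and the tails occurring in [limsup]. *)
Lemma countable_image_lt (mu : Omega) (P : Omega -> bool) (u : Omega -> Omega) :
  countable [set u xi | xi in [set xi | P xi && (xi < mu)]].
Proof.
apply: (@sub_countable _ _ _ [set xi : Omega | xi <= mu]);
  last exact: countable_below.
apply: card_le_trans (card_image_le _ _) _.
by apply: subset_card_le => xi /andP[_ /ltW].
Qed.

Lemma osup_limP mu u :
  (forall xi, xi < mu -> u xi <= osup_lim mu u) /\
  (forall m, (forall xi, xi < mu -> u xi <= m) -> osup_lim mu u <= m).
Proof.
have [ub lub] := osupP (countable_image_lt mu predT u).
split => [xi xim|m h]; first by apply: ub; exists xi.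
by apply: lub => _ [xi xim <-]; apply: h.
Qed.

(** * The preorders [fle] and [hple], and the equivalence [hpeq] *)

Lemma fle_refl s (x : Fun s) : fle x x.
Proof. by elim: s x => [|s _ t IHt] x //= y; apply: IHt. Qed.

Lemma fle_trans s (x y z : Fun s) : fle x y -> fle y z -> fle x z.
Proof.
elim: s x y z => [|s _ t IHt] x y z /=; first exact: le_trans.
by move=> xy yz w; apply: IHt (xy w) (yz w).
Qed.

Lemma hple_refl s (x : Fun s) : hple s x x.
Proof.
elim: s x => [|s _ t IHt] x; first by rewrite hple_base.
have [e|ne] := pselect (s = t); last by rewrite hple_arr_neq //; apply: fle_refl.
by subst s; rewrite hple_arr.
Qed.

Lemma hple_trans s (x y z : Fun s) : hple s x y -> hple s y z -> hple s x z.
Proof.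
elim: s x y z => [|s _ t IHt] x y z.
  by rewrite !hple_base; exact: le_trans.
have [e|ne] := pselect (s = t); last by rewrite !hple_arr_neq //; apply: fle_trans.
by subst s; rewrite !hple_arr => xy yz w hw; apply: IHt (xy w hw) (yz w hw).
Qed.

Lemma hpeq_refl s (x : Fun s) : hpeq s x x.
Proof. by split; apply: hple_refl. Qed.

Lemma hpeq_trans s (x y z : Fun s) : hpeq s x y -> hpeq s y z -> hpeq s x z.
Proof.
by move=> [xy yx] [yz zy]; split; [apply: hple_trans xy yz|apply: hple_trans zy yx].
Qed.

Lemma hpeq_arr t (f g : Fun (t ~~> t)) :
  hpeq (t ~~> t) f g <-> forall x, hp t x -> hpeq t (f x) (g x).
Proof.
rewrite /hpeq !hple_arr; split => [[fg gf] x hx|h].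
  by split; [apply: fg|apply: gf].
by split => x /h[].
Qed.

(** Used in the successor steps of the three laws to apply an induction hypothesis under a
    functional. *)
Lemma hp_hpeq t (f : Fun (t ~~> t)) x y :
  hp (t ~~> t) f -> hp t x -> hp t y -> hpeq t x y -> hpeq t (f x) (f y).
Proof. by rewrite hp_arr => -[_ _ fm] hx hy [xy yx]; split; apply: fm. Qed.

(** * Limsups of eventually increasing families *)

Lemma limsup_app s t mu (u : Omega -> Fun (s ~~> t)) x :
  limsup mu u x = limsup mu (fun xi => u xi x).
Proof.
rewrite /limsup /= image_comp; congr finf.
by apply: eq_imagel => a _ /=; rewrite image_comp.
Qed.

(** The threshold [d] is there for the iterates of [Iter t ozero], whose behaviour is controlled
    only from index [oone] on; elsewhere [d] is [ozero]. *)
Definition tail_incr (T : Type) (le : T -> T -> Prop) (d mu : Omega)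
    (u : Omega -> T) :=
  forall xi eta, d <= xi -> xi <= eta -> eta < mu -> le (u xi) (u eta).

Definition tail_lub (T : Type) (le : T -> T -> Prop) (d mu : Omega)
    (u : Omega -> T) (l : T) :=
  (forall xi, d <= xi -> xi < mu -> le (u xi) l) /\
  (forall m, (forall xi, d <= xi -> xi < mu -> le (u xi) m) -> le l m).

Lemma limsup_base_lub d mu (u : Omega -> Fun base) : d < mu ->
  tail_incr (@fle base) d mu u -> tail_lub (@fle base) d mu u (limsup mu u).
Proof.
move=> dmu ui; rewrite /limsup /=.
set A := (X in oinf X).
have ub a xi : a <= xi -> xi < mu ->
    u xi <= osup [set u xi | xi in [set xi | a <= xi < mu]].
  move=> axi ximu; have [+ _] := osupP (countable_image_lt mu (>= a) u).
  by apply; exists xi => //=; rewrite axi.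
(* By well-ordering the infimum is attained, at the tail starting at some [a]. Terms with index
   below [a] are bounded by [u a], which lies in that tail; leastness uses the tail starting at
   [d]. *)
have [|[a amu /= aE] Ale] := @oinfP A; first by eexists; exists d.
split => [xi dxi ximu|m h] /=.
- rewrite -aE; have [axi|/ltW xia] := leP a xi; first exact: ub.
  exact: le_trans (ui _ _ dxi xia amu) (ub _ _ (lexx a) amu).
- apply: le_trans (Ale _ (ex_intro2 _ _ d dmu erefl)) _.
  have [_ +] := osupP (countable_image_lt mu (>= d) u).
  by apply=> _ [xi /= /andP[dxi ximu] <-]; apply: h.
Qed.

(** Needed at arrow types with distinct sides, where [hple] is by definition the pointwise order on
    all arguments. *)
Lemma limsup_fle_lub s d mu (u : Omega -> Fun s) : d < mu ->
  tail_incr (@fle s) d mu u -> tail_lub (@fle s) d mu u (limsup mu u).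
Proof.
move=> dmu; elim: s u => [|s _ t IHt] u; first exact: limsup_base_lub.
move=> ui; have IHx y : tail_lub (@fle t) d mu (u^~ y) (limsup mu (u^~ y)).
  by apply: IHt => xi eta dxi xieta etamu; apply: ui.
split => [xi dxi ximu y|m h y]; rewrite limsup_app.
- exact: (IHx y).1.
- by apply: (IHx y).2 => xi dxi ximu; apply: h.
Qed.

Lemma limsup_hple_lub s d mu (u : Omega -> Fun s) : d < mu ->
  tail_incr (hple s) d mu u -> tail_lub (hple s) d mu u (limsup mu u).
Proof.
move=> dmu; elim: s u => [|s _ t IHt] u; first exact: limsup_base_lub.
have [e|ne] := pselect (s = t); last first.
  have -> : hple (s ~~> t) = @fle (s ~~> t).
    by apply/funext => f; apply/funext => g; rewrite hple_arr_neq.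
  exact: limsup_fle_lub.
subst s => ui.
have IHx y : hp t y -> tail_lub (hple t) d mu (u^~ y) (limsup mu (u^~ y)).
  move=> hy; apply: IHt => xi eta dxi xieta etamu.
  by have := ui _ _ dxi xieta etamu; rewrite hple_arr; apply.
split => [xi dxi ximu|m h]; rewrite hple_arr => y hy; rewrite limsup_app.
- exact: (IHx y hy).1.
- apply: (IHx y hy).2 => xi dxi ximu.
  by have := h _ dxi ximu; rewrite hple_arr; apply.
Qed.

(** The h.p. conditions pass to a least upper bound: values are h.p. by induction on the type, and
    the two inequalities follow from those of the members of the tail. *)
Lemma limsup_hp s d mu (u : Omega -> Fun s) : d < mu ->
  tail_incr (hple s) d mu u -> (forall xi, xi < mu -> hp s (u xi)) ->
  hp s (limsup mu u).
Proof.
move=> dmu; elim: s u => [|s _ t IHt] u ui hu; first exact: hp_base.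
have [e|ne] := pselect (s = t); last exact: hp_arr_neq.
subst s.
have hux xi y : xi < mu -> hp t y -> hp t (u xi y).
  by move=> /hu; rewrite hp_arr => -[h _ _]; apply: h.
have uix y : hp t y -> tail_incr (hple t) d mu (u^~ y).
  move=> hy xi eta dxi xieta etamu.
  by have := ui _ _ dxi xieta etamu; rewrite hple_arr; apply.
rewrite hp_arr; split => [y hy|y hy|y z hy hz yz]; rewrite !limsup_app.
- by apply: IHt; [exact: uix|move=> xi ximu; apply: hux].
(* The member at index [d] suffices: [y] is below [u d y], which is below the limsup. *)
- apply: hple_trans ((limsup_hple_lub dmu (uix y hy)).1 d (lexx d) dmu).
  by have := hu _ dmu; rewrite hp_arr => -[_ + _]; apply.
- apply: (limsup_hple_lub dmu (uix y hy)).2 => xi dxi ximu.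
  apply: hple_trans ((limsup_hple_lub dmu (uix z hz)).1 xi dxi ximu).
  by have := hu _ ximu; rewrite hp_arr => -[_ _]; apply.
Qed.

(** * Positivity and monotonicity of the iterates *)

Section Iterates.
Variables (t : ftype).
Implicit Types (f g : Fun (t ~~> t)) (x y m : Fun t) (a b mu : Omega).

(** The two claims depend on each other: a limsup is h.p. because the earlier iterates increase, and
    [f] raises an iterate because that iterate is h.p. *)
Lemma Iter_hp_incr f x : hp (t ~~> t) f -> hp t x -> forall b,
  hp t (Iter t b f x) /\
  forall a, a <= b -> hple t (Iter t a f x) (Iter t b f x).
Proof.
rewrite hp_arr => -[fh fx _] hx; elim/Omega_ind => [|b [hb ib]|mu mulim IH].
- rewrite Iter0; split=> // a a0.
  have -> : a = ozero by apply/le_anti; rewrite a0 ozero_le.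
  by rewrite Iter0; apply: hple_refl.
- split=> [|a]; first by rewrite IterS; apply: fh.
  rewrite le_eqVlt lto_succ => /orP[/eqP->|ab]; first exact: hple_refl.
  by apply: hple_trans (ib _ ab) _; rewrite IterS; apply: fx.
- have ui : tail_incr (hple t) ozero mu (fun xi => Iter t xi f x).
    by move=> xi eta _ xieta /IH[_]; apply.
  have mu0 := limit_gt0 mulim; split=> [|a].
    by rewrite (Iter_lim _ _ mulim); apply: limsup_hp mu0 ui _ => xi /IH[].
  rewrite le_eqVlt => /orP[/eqP->|amu]; first exact: hple_refl.
  rewrite (Iter_lim _ _ mulim); exact: (limsup_hple_lub mu0 ui).1 a (ozero_le a) amu.
Qed.

Lemma Iter_app_hp a f x : hp (t ~~> t) f -> hp t x -> hp t (Iter t a f x).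
Proof. by move=> hf hx; case: (Iter_hp_incr hf hx a). Qed.

Lemma Iter_incr f x a b : hp (t ~~> t) f -> hp t x -> a <= b ->
  hple t (Iter t a f x) (Iter t b f x).
Proof. by move=> hf hx; apply: (Iter_hp_incr hf hx b).2. Qed.

Lemma Iter_tail_incr f x d mu : hp (t ~~> t) f -> hp t x ->
  tail_incr (hple t) d mu (fun xi => Iter t xi f x).
Proof. by move=> hf hx xi eta _ xieta _; apply: Iter_incr. Qed.

Lemma Iter_lim_lub f x mu : hp (t ~~> t) f -> hp t x -> is_limit mu ->
  tail_lub (hple t) ozero mu (fun xi => Iter t xi f x) (Iter t mu f x).
Proof.
move=> hf hx mulim; rewrite (Iter_lim _ _ mulim).
exact: limsup_hple_lub (limit_gt0 mulim) (Iter_tail_incr hf hx).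
Qed.

Lemma Iter_mono f g x y a :
  hp (t ~~> t) f -> hp (t ~~> t) g -> hp t x -> hp t y ->
  hple (t ~~> t) f g -> hple t x y -> hple t (Iter t a f x) (Iter t a g y).
Proof.
move=> hf hg hx hy; rewrite hple_arr => fg xy.
elim/Omega_ind: a => [|a IH|mu mulim IH]; first by rewrite !Iter0.
(* First replace [f] by [g] at the h.p. point [Iter t a f x], then use that [g] is monotone. *)
- rewrite !IterS; apply: hple_trans (fg _ (Iter_app_hp a hf hx)) _.
  have := hg; rewrite hp_arr => -[_ _]; apply=> //; exact: Iter_app_hp.
- apply: (Iter_lim_lub hf hx mulim).2 => xi _ ximu.
  apply: hple_trans (IH _ ximu) _; exact/Iter_incr/ltW.
Qed.

(** This includes [a] equal to [ozero], where [Iter t a f] is the identity; so the product law needs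
    no case distinction. *)
Lemma Iter_hp a f : hp (t ~~> t) f -> hp (t ~~> t) (Iter t a f).
Proof.
move=> hf; rewrite hp_arr; split => [x hx|x hx|x y hx hy xy].
- exact: Iter_app_hp.
- by have := Iter_incr hf hx (ozero_le a); rewrite Iter0.
- by apply: Iter_mono => //; apply: hple_refl.
Qed.

Lemma Iter_hp_functional a :
  a <> ozero -> hp ((t ~~> t) ~~> (t ~~> t)) (Iter t a).
Proof.
(* From [oone <= a], the functional [f], which is its own first iterate, lies below [Iter t a f]. *)
move=> /lt0o/(osuccP _).2 a1; rewrite hp_arr.
split => [f hf|f hf|f g hf hg fg]; first exact: Iter_hp.
- rewrite hple_arr => x hx.
  by have := Iter_incr hf hx a1; rewrite IterS Iter0.
- by rewrite hple_arr => x hx; apply: Iter_mono => //; apply: hple_refl.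
Qed.

(* If the supremum is attained this is clear; otherwise it is a limit ordinal
   and the u xi are cofinal in it. *)
Lemma Iter_osup_lim_le f x m mu (u : Omega -> Omega) :
  hp (t ~~> t) f -> hp t x -> ozero < mu ->
  (forall xi, xi < mu -> hple t (Iter t (u xi) f x) m) ->
  hple t (Iter t (osup_lim mu u) f x) m.
Proof.
move=> hf hx mu0 um; have [ub lub] := osup_limP mu u.
set s := osup_lim mu u in ub lub *.
have below a : a < s -> exists2 xi, xi < mu & a < u xi.
  move=> as_; apply: contrapT => no; move: as_; rewrite ltNge.
  move=> /negP; apply; apply: lub => xi ximu; rewrite leNgt.
  by apply/negP => auxi; apply: no; exists xi.
have [[xi ximu <-]|natt] := pselect (exists2 xi, xi < mu & u xi = s).
  exact: um.
have slim : is_limit s.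
  split=> [s0|[a sa]].
    apply: natt; exists ozero => //; apply/le_anti.
    by rewrite ub //= s0 ozero_le.
  have [|xi ximu auxi] := below a; first by rewrite sa (osuccP a).1.
  apply: natt; exists xi => //; apply/le_anti.
  by rewrite ub //= {1}sa; apply: (osuccP a).2.
apply: (Iter_lim_lub hf hx slim).2 => a _ /below[xi ximu /ltW auxi].
exact: hple_trans (Iter_incr hf hx auxi) (um _ ximu).
Qed.

(** The limit step shared by the three laws, with [u] the ordinal sum, product or power as a
    function of its right argument. *)
Lemma limsup_Iter_osup_lim f x mu (u : Omega -> Omega) (v : Omega -> Fun t) :
  hp (t ~~> t) f -> hp t x -> ozero < mu ->
  tail_incr (hple t) ozero mu v ->
  (forall xi, xi < mu -> hpeq t (v xi) (Iter t (u xi) f x)) ->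
  hpeq t (limsup mu v) (Iter t (osup_lim mu u) f x).
Proof.
move=> hf hx mu0 vi vu; have [vub vlub] := limsup_hple_lub mu0 vi; split.
- apply: vlub => xi _ ximu; apply: hple_trans (vu _ ximu).1 _.
  exact/Iter_incr/(osup_limP mu u).1.
- apply: Iter_osup_lim_le => // xi ximu.
  exact: hple_trans (vu _ ximu).2 (vub _ (ozero_le xi) ximu).
Qed.

(** * The laws for sums, products and powers *)

Lemma Iter_oadd f x a c : hp (t ~~> t) f -> hp t x ->
  hpeq t (Iter t a f (Iter t c f x)) (Iter t (oadd c a) f x).
Proof.
move=> hf hx; have hc := Iter_app_hp c hf hx.
elim/Omega_ind: a => [|a IH|mu mulim IH].
- by rewrite Iter0 /oadd trec0; apply: hpeq_refl.
- by rewrite /oadd trecS !IterS; apply: hp_hpeq => //; apply: Iter_app_hp.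
- rewrite /oadd trec_osup_lim // (Iter_lim _ _ mulim).
  apply: limsup_Iter_osup_lim IH => //; first exact: limit_gt0.
  exact: Iter_tail_incr.
Qed.

Lemma Iter_omul f a c : hp (t ~~> t) f ->
  hpeq (t ~~> t) (Iter t a (Iter t c f)) (Iter t (omul c a) f).
Proof.
move=> hf; apply/hpeq_arr => x hx; have hc := Iter_hp c hf.
elim/Omega_ind: a => [|a IH|mu mulim IH].
- by rewrite /omul trec0 !Iter0; apply: hpeq_refl.
(* One more application of [Iter t c f] after [omul c a] steps of [f] adds [c] steps, by the sum
   law. *)
- rewrite /omul trecS IterS; apply: hpeq_trans (Iter_oadd _ _ hf hx).
  by apply: hp_hpeq => //; apply: Iter_app_hp.
- rewrite /omul trec_osup_lim // (Iter_lim _ _ mulim).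
  apply: limsup_Iter_osup_lim IH => //; first exact: limit_gt0.
  exact: Iter_tail_incr.
Qed.

(** [Iter t ozero] ignores its functional argument, which settles successors without induction. At a
    limit the family is constant up to [hpeq] from [oone] on, while its member at [ozero] is [f]
    itself; hence the limsup is taken along the tail from [oone]. *)
Lemma Iter_Iter0 f a : a <> ozero ->
  hpeq (t ~~> t) (Iter (t ~~> t) a (Iter t ozero) f) (Iter t ozero f).
Proof.
have E g : Iter t ozero g = Iter t ozero f.
  by apply/funext => x; rewrite !Iter0.
elim/Omega_ind: a => [//|a _ _|mu mulim IH _].
  by rewrite IterS E; apply: hpeq_refl.
pose v xi := Iter (t ~~> t) xi (Iter t ozero) f.
have vE xi : oone <= xi -> xi < mu -> hpeq (t ~~> t) (v xi) (Iter t ozero f).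
  move=> xi1 ximu; apply: IH => // xi0; move: xi1.
  by rewrite xi0 leNgt (osuccP ozero).1.
have mu1 : oone < mu by apply: limit_succ_lt (limit_gt0 mulim).
have vi : tail_incr (hple (t ~~> t)) oone mu v.
  move=> xi eta xi1 xieta etamu.
  apply: hple_trans (vE _ xi1 (le_lt_trans xieta etamu)).1 _.
  exact: (vE _ (le_trans xi1 xieta) etamu).2.
have [vub vlub] := limsup_hple_lub mu1 vi.
rewrite (Iter_lim _ _ mulim); split; first by apply: vlub => xi xi1 /(vE _ xi1)[].
exact: hple_trans (vE _ (lexx _) mu1).2 (vub _ (lexx _) mu1).
Qed.

End Iterates.

Lemma Iter_oexp t f a c : hp (t ~~> t) f ->
  hpeq (t ~~> t) (Iter (t ~~> t) a (Iter t c) f) (Iter t (oexp c a) f).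
Proof.
move=> hf.
have base0 : hpeq (t ~~> t) (Iter (t ~~> t) ozero (Iter t c) f)
                            (Iter t (oexp c ozero) f).
  (* The zeroth power is [oone], and one iteration of [f] is [f]. *)
  by rewrite Iter0 oexpr0; apply/hpeq_arr => x hx; rewrite IterS Iter0; apply: hpeq_refl.
have [c0|c0] := pselect (c = ozero).
  have [->//|a0] := pselect (a = ozero).
  by rewrite c0 oexp0r //; apply: Iter_Iter0.
have hc := @Iter_hp_functional t c c0.
elim/Omega_ind: a => [//|a IH|mu mulim IH].
(* Applying [Iter t c] to [Iter t (oexp c a) f] multiplies the exponent ordinal by [c], by the
   product law. *)
- rewrite IterS oexprS; apply: hpeq_trans (Iter_omul _ _ hf).
  by apply: hp_hpeq IH => //; [apply: Iter_app_hp|apply: Iter_hp].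
(* This equation relies on [c] being nonzero: for base zero the supremum would be [oone],
   contributed by the zeroth power. *)
- have -> : oexp c mu = osup_lim mu (oexp c).
    rewrite /oexp; case: eqP => // _; exact: trec_osup_lim.
  apply/hpeq_arr => x hx; rewrite (Iter_lim _ _ mulim) limsup_app.
  apply: limsup_Iter_osup_lim => //; first exact: limit_gt0.
    (* Monotonicity is that of the iterates one type higher, of the h.p. functional [Iter t c]
       started at [f], evaluated at [x]. *)
    move=> xi eta _ xieta _.
    by have := Iter_incr hc hf xieta; rewrite hple_arr; apply.
  by move=> xi /IH/hpeq_arr; apply.
Qed.

Theorem theorem4p9 (tau : ftype) (f : Fun (tau ~~> tau)) (x : Fun tau)
    (hf : hp (tau ~~> tau) f) (hx : hp tau x) (alpha gamma : Omega) :
  hpeq tau (Iter tau alpha f (Iter tau gamma f x)) (Iter tau (oadd gamma alpha) f x)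
  /\ hpeq (tau ~~> tau) (Iter tau alpha (Iter tau gamma f)) (Iter tau (omul gamma alpha) f)
  /\ hpeq ((tau ~~> tau) ~~> (tau ~~> tau))
       (Iter (tau ~~> tau) alpha (Iter tau gamma)) (Iter tau (oexp gamma alpha)).
Proof.
split; first exact: Iter_oadd.
split; first exact: Iter_omul.
by apply/hpeq_arr => g hg; apply: Iter_oexp.
Qed.
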